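(* Let $\mathcal{H}$ be a separable infinite-dimensional Hilbert space and let $B(\mathcal{H})$ be the space of all bounded linear operators on $\mathcal{H}$ with the operator norm. The set of all operators in $B(\mathcal{H})$ which are not positive semidefinite is spaceable in $B(\mathcal{H})$.
   Context: A subset $S$ of a Banach space $Y$ is called spaceable in $Y$ if $S\cup\{0\}$ contains a closed infinite-dimensional linear subspace of $Y$. *)

(* Defs.v *)
From HB Require Import structures.
From mathcomp Require Import all_boot all_order all_algebra.
From mathcomp Require Import sesquilinear complex.
From mathcomp Require Import all_classical all_reals all_analysis.

Set Implicit Arguments.
Unset Strict Implicit.
Unset Printing Implicit Defensive.

Import Order.TTheory GRing.Theory Num.Theory.
Import numFieldNormedType.Exports.

Local Open Scope classical_set_scope.
Local Open Scope ring_scope.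

(* Scalar fields: R itself and R[i] are the instances given below. By
   the Gelfand-Mazur theorem there are no others, since `|_| is a multiplicative norm
   on K extending the absolute value of R. *)
HB.mixin Record isRealOrComplex (R : realType) K & Num.NumField K := {
  of_real : {rmorphism R -> K};
  of_real_ge0 : forall r : R, 0 <= r -> 0 <= of_real r;
  ge0_of_real : forall x : K, 0 <= x -> exists r : R, x = of_real r;
  conjs : {rmorphism K -> K};
  mulr_conjs : forall x : K, x * conjs x = `|x| ^+ 2
}.

#[short(type="rclikeType")]
HB.structure Definition RealOrComplex (R : realType) :=
  {K of Num.NumField K & isRealOrComplex R K}.
Arguments of_real {R s}.
Arguments ge0_of_real {R s}.
Arguments conjs {R s}.

Section real_scalars.
Variable R : realType.

Let real_of_real_ge0 (r : R) : 0 <= r -> 0 <= (idfun : {rmorphism R -> R}) r.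
Proof. by []. Qed.

Let real_ge0_of_real (x : R) :
  0 <= x -> exists r : R, x = (idfun : {rmorphism R -> R}) r.
Proof. by exists x. Qed.

Let real_mulr_conjs (x : R) : x * (idfun : {rmorphism R -> R}) x = `|x| ^+ 2.
Proof. by rewrite /= -expr2 real_normK ?num_real. Qed.

#[non_forgetful_inheritance]
HB.instance Definition _ := @isRealOrComplex.Build R R
  idfun real_of_real_ge0 real_ge0_of_real idfun real_mulr_conjs.

End real_scalars.

Section complex_scalars.
Variable R : realType.

Let complex_of_real : {rmorphism R -> R[i]} := real_complex_def (Phant R).

Let conjc_rmorphism : {rmorphism R[i] -> R[i]} := @conjc R.

Let complex_of_real_ge0 (r : R) : 0 <= r -> 0 <= complex_of_real r.
Proof. by rewrite /complex_of_real/= ler0c. Qed.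

Let complex_ge0_of_real (x : R[i]) :
  0 <= x -> exists r : R, x = complex_of_real r.
Proof.
case: x => a b; rewrite lecE /= => /andP[/eqP -> _].
by exists a.
Qed.

Let complex_mulr_conjs (x : R[i]) : x * conjc_rmorphism x = `|x| ^+ 2.
Proof. by rewrite sqr_normc. Qed.

HB.instance Definition _ := @isRealOrComplex.Build R R[i]
  complex_of_real complex_of_real_ge0 complex_ge0_of_real
  conjc_rmorphism complex_mulr_conjs.

End complex_scalars.

(* The inner product is linear in its first argument. *)
HB.mixin Record NormedModule_isInner (R : realType) (K : rclikeType R) H
    & NormedModule K H := {
  inner : {dot H for (conjs : K -> K)};
  sqr_norm_inner : forall x : H, `|x| ^+ 2 = inner x x
}.

#[short(type="hilbertType")]
HB.structure Definition Hilbert (R : realType) (K : rclikeType R) :=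
  {H of CompleteNormedModule K H & NormedModule_isInner R K H}.

Section of_real_theory.
Context {R : realType} {K : rclikeType R}.
Local Notation of_real := (of_real : R -> K).

Lemma ler_of_real (r s : R) : (of_real r <= of_real s) = (r <= s).
Proof.
have mono r' s' : r' <= s' -> of_real r' <= of_real s'.
  by move=> rs; rewrite -subr_ge0 -rmorphB of_real_ge0// subr_ge0.
apply/idP/idP => [rs|]; last exact: mono.
rewrite leNgt; apply/negP => sr.
have : of_real r == of_real s by rewrite eq_le rs mono// ltW.
by rewrite fmorph_eq; apply/negP; rewrite gt_eqF.
Qed.

Lemma of_real_ge0E (r : R) : (0 <= of_real r) = (0 <= r).
Proof. by rewrite -ler_of_real rmorph0. Qed.

Lemma of_real_surj (x : K) : 0 <= x -> exists2 r : R, 0 <= r & x = of_real r.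
Proof.
move=> x0; have [r xE] := ge0_of_real x x0; exists r => //.
by rewrite -of_real_ge0E -xE.
Qed.

End of_real_theory.

Section bounded_operators.
Context {R : realType} {K : rclikeType R}.
Variables V W : normedModType K.

Definition bounded_linear : {pred V -> W} :=
  mem [set f : V -> W |
    linear f /\ exists M : K, forall x, `|f x| <= M * `|x|].

Lemma bounded_linear_submod_closed : submod_closed bounded_linear.
Proof.
split => [|a f g].
  rewrite inE; split; first by move=> a x y; rewrite /= scaler0 addr0.
  by exists 0 => x; rewrite normr0 mul0r.
rewrite !inE => -[lf [M fM]] [lg [N gN]]; split.
  move=> b x y; rewrite !fctE lf lg !scalerDr !scalerA [a * b]mulrC -!addrA.
  by congr (_ + _); rewrite addrCA.
exists (`|a| * M + N) => x /=; rewrite (le_trans (ler_normD _ _))//.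
by rewrite mulrDl lerD// normrZ -mulrA ler_wpM2l.
Qed.

HB.instance Definition _ :=
  GRing.isSubmodClosed.Build K (V -> W) bounded_linear
    bounded_linear_submod_closed.

Definition boundedOp := {f : V -> W | f \in bounded_linear}.
HB.instance Definition _ := SubChoice.on boundedOp.
HB.instance Definition _ := [SubChoice_isSubLmodule of boundedOp by <:].

Definition boundedOp_fun (T : boundedOp) : V -> W := val T.
Coercion boundedOp_fun : boundedOp >-> Funclass.

Implicit Types S T : boundedOp.

Lemma boundedOpP T :
  linear T /\ exists M : K, forall x, `|T x| <= M * `|x|.
Proof. by have := valP T; rewrite inE. Qed.

Lemma boundedOp_linear T : linear T.
Proof. by case: (boundedOpP T). Qed.

HB.instance Definition _ T :=
  GRing.isLinear.Build K V W *:%R (boundedOp_fun T) (boundedOp_linear T).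

Lemma boundedOpD S T x : (S + T : boundedOp) x = S x + T x.
Proof. by []. Qed.

Lemma boundedOpZ (a : K) T x : (a *: T : boundedOp) x = a *: T x.
Proof. by []. Qed.

Lemma boundedOpN T x : (- T : boundedOp) x = - T x.
Proof. by []. Qed.

Lemma boundedOp0 x : (0 : boundedOp) x = 0.
Proof. by []. Qed.

Lemma boundedOp_ext S T : S =1 T -> S = T.
Proof. by move=> ST; apply/val_inj/funext. Qed.

Definition opbound T : set R :=
  [set r | 0 <= r /\ forall x, `|T x| <= of_real r * `|x|].

Definition opnorm T : K := of_real (inf (opbound T)).

Lemma opbound_nonempty T : opbound T !=set0.
Proof.
have [_ [M TM]] := boundedOpP T.
have [r r0 Mr] : exists2 r : R, 0 <= r & `|M| = of_real r.
  exact: of_real_surj.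
exists r; split => // x; rewrite -Mr -[X in _ * X]normr_id -normrM.
by rewrite (le_trans (TM x))// real_ler_norm// ger0_real// (le_trans _ (TM x)).
Qed.

Lemma inf_opbound_ge0 T : 0 <= inf (opbound T).
Proof. by apply: lb_le_inf; [exact: opbound_nonempty | move=> r []]. Qed.

Lemma opnorm_ge0 T : 0 <= opnorm T.
Proof. by rewrite of_real_ge0E inf_opbound_ge0. Qed.

Lemma le_opnorm T x : `|T x| <= opnorm T * `|x|.
Proof.
have [->|x0] := eqVneq x 0; first by rewrite linear0 !normr0 mulr0.
have nx0 : 0 < `|x| by rewrite normr_gt0.
have [t t0 tE] : exists2 t : R, 0 <= t & `|T x| / `|x| = of_real t.
  by apply: of_real_surj; rewrite divr_ge0.
rewrite -ler_pdivrMr// tE ler_of_real; apply: lb_le_inf.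
  exact: opbound_nonempty.
by move=> r [_ /(_ x)]; rewrite -ler_pdivrMr// tE ler_of_real.
Qed.

Lemma opnorm_le T (M : K) :
  0 <= M -> (forall x, `|T x| <= M * `|x|) -> opnorm T <= M.
Proof.
move=> /of_real_surj[r r0 ->] TM; rewrite ler_of_real; apply: ge_inf => //.
by exists 0 => s [].
Qed.

Lemma opnorm_triangle S T : opnorm (S + T) <= opnorm S + opnorm T.
Proof.
apply: opnorm_le => [|x]; first by rewrite addr_ge0 ?opnorm_ge0.
by rewrite boundedOpD (le_trans (ler_normD _ _))// mulrDl lerD ?le_opnorm.
Qed.

Let opnormZ_le (a : K) T : opnorm (a *: T) <= `|a| * opnorm T.
Proof.
apply: opnorm_le => [|x]; first by rewrite mulr_ge0 ?opnorm_ge0.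
by rewrite boundedOpZ normrZ -mulrA ler_wpM2l ?le_opnorm.
Qed.

Lemma opnormZ (a : K) T : opnorm (a *: T) = `|a| * opnorm T.
Proof.
apply/eqP; rewrite eq_le opnormZ_le /=.
have [->|a0] := eqVneq a 0; first by rewrite normr0 mul0r opnorm_ge0.
rewrite -ler_pdivlMl ?normr_gt0// -normfV.
by rewrite -{1}[T]scale1r -(mulVf a0) -scalerA opnormZ_le.
Qed.

Lemma opnorm_eq0 T : opnorm T = 0 -> T = 0.
Proof.
move=> T0; apply: boundedOp_ext => x; apply/eqP; rewrite -normr_le0.
by rewrite (le_trans (le_opnorm T x))// T0 mul0r.
Qed.

HB.instance Definition _ := Lmodule_isNormed.Build K boundedOp
  opnorm_triangle opnormZ opnorm_eq0.

Lemma opnormE T : `|T| = opnorm T.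
Proof. by []. Qed.

End bounded_operators.
Arguments boundedOp {R K} V W.

Section bounded_operators_complete.
Context {R : realType} {K : rclikeType R}.
Variables (V : normedModType K) (W : completeNormedModType K).
Local Notation B := (boundedOp V W).
Implicit Types S T : B.

Let ball_boundedOp T (e : K) S x : ball T e S -> `|T x - S x| <= e * `|x|.
Proof.
rewrite -ball_normE /ball_ /= => TSe.
have -> : T x - S x = (T - S : B) x by [].
by rewrite (le_trans (le_opnorm _ _))// ler_wpM2r// -opnormE ltW.
Qed.

Lemma boundedOp_complete (F : set_system B) :
  ProperFilter F -> cauchy F -> cvg F.
Proof.
move=> FF /cauchyP Fc.
have ptcvg x : cvg ((fun T : B => T x) @ F).
  apply/cauchy_cvgP/cauchyP => e e0.
  have ex0 : 0 < e / (`|x| + 1) by rewrite divr_gt0// ltr_wpDl.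
  have [T FT] := Fc _ ex0; exists ((T : B) x).
  apply: (@filterS _ F _ _ _ _ FT) => S /(@ball_boundedOp T _ S x) TS.
  rewrite -ball_normE /ball_ /= (le_lt_trans TS)// mulrAC ltr_pdivrMr ?ltr_wpDl//.
  by rewrite ltr_pM2l// ltrDl.
pose l x := lim ((fun T : B => T x) @ F).
have lP x : (fun T : B => T x) @ F --> l x by exact: ptcvg.
have l_near T (e : K) x : 0 <= e -> F (ball T e) -> `|T x - l x| <= e * `|x|.
  move=> e0 FT.
  apply/ler_addgt0Pr => d d0.
  have [S [/= TS lS]] : exists S : B, ball T e S /\ `|l x - S x| < d.
    apply: (@filter_ex _ F); apply: filterI => //.
    by move/cvgrPdist_lt: (lP x); exact.
  rewrite (le_trans (ler_distD (S x) _ _))// lerD ?ball_boundedOp//.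
  by rewrite distrC ltW.
have l_linear : linear l.
  move=> a x y; apply: (cvg_unique _ (lP _)); first exact: norm_hausdorff.
  rewrite (_ : (fun T : B => T (a *: x + y)) = (fun T : B => a *: T x + T y)).
    by apply: cvgD; [apply: cvgZr; exact: lP | exact: lP].
  by apply/funext => T; rewrite linearP.
have l_bounded : exists M : K, forall x, `|l x| <= M * `|x|.
  have [T FT] := Fc _ (@ltr01 K); exists (1 + opnorm T) => x.
  rewrite -[l x](subrK ((T : B) x)) (le_trans (ler_normD _ _))// mulrDl lerD//.
    by rewrite distrC l_near.
  exact: le_opnorm.
have lB : l \in @bounded_linear R K V W by rewrite inE.
pose L : B := exist _ l lB.
apply/cvg_ex; exists L; apply/cvgrPdist_lt => e e0.
have e20 : 0 < e / 2 by rewrite divr_gt0.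
have [T FT] := Fc _ e20; near=> S.
have TS : ball T (e / 2) S by near: S.
have LT : `|L - (T : B)| <= e / 2.
  apply: opnorm_le => [|x]; first exact: ltW.
  by rewrite boundedOpD boundedOpN distrC l_near// ltW.
rewrite (le_lt_trans (ler_distD T _ _))//.
by rewrite [ltRHS]splitr ler_ltD.
Unshelve. all: by end_near. Qed.

HB.instance Definition _ := Uniform_isComplete.Build B boundedOp_complete.
End bounded_operators_complete.

Section spaceability.
Context {K : numFieldType}.

Definition finite_dimensional (V : lmodType K) (E : set V) :=
  exists (n : nat) (e : 'I_n -> V), (forall i, E (e i)) /\
    E `<=` [set v | exists c : 'I_n -> K, v = \sum_(i < n) c i *: e i].

Definition spaceable (Y : completeNormedModType K) (S : set Y) :=
  exists E : set Y, [/\ submod_closed (mem E), closed E,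
    ~ finite_dimensional E & E `<=` S `|` [set 0]].

End spaceability.

Definition separable (T : topologicalType) :=
  exists2 D : set T, countable D & dense D.

Section positive_semidefinite.
Context {R : realType} {K : rclikeType R} {H : hilbertType K}.

(* `0 <= z' in R[i] means that z is real and nonnegative. *)
Definition positive_semidefinite (T : boundedOp H H) :=
  forall x : H, 0 <= inner (T x) x.

End positive_semidefinite.

(* Main.v *)
(* Fix u <> 0 and consider the rank-one operators x |-> <x, u> w with w
   orthogonal to u.  They form a closed subspace isomorphic to the orthogonal
   complement of u, and the quadratic form of such an operator at u - w is
   - |u|^2 |w|^2, so the only positive semidefinite one is 0. *)

Require Import Defs.
From mathcomp Require Import all_boot all_order all_algebra.
From mathcomp Require Import sesquilinear.
From mathcomp Require Import all_classical all_reals all_analysis.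

Import Order.TTheory GRing.Theory Num.Theory.
Import numFieldNormedType.Exports.

Local Open Scope classical_set_scope.
Local Open Scope ring_scope.

(** This turns approximation up to an arbitrary [e] into vanishing of the limit. As [M] may be 0,
    the proof takes [e = d / (M + 1)]. *)
Lemma normr_le_eps_eq0 (K : numFieldType) (V : normedModType K) (z : V) (M : K) :
  0 <= M -> (forall e, 0 < e -> `|z| <= e * M) -> z = 0.
Proof.
move=> M0 zM; apply/eqP; rewrite -normr_le0.
apply/ler_addgt0Pr => d d0; rewrite add0r.
rewrite (le_trans (zM (d / (M + 1)) _)) ?divr_gt0 ?ltr_wpDl//.
by rewrite mulrAC ler_pdivrMr ?ltr_wpDl// ler_pM2l// lerDl.
Qed.

Section inner_theory.
Context {R : realType} {K : rclikeType R} {H : hilbertType K}.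
Implicit Types (a : K) (u x y z : H).

Lemma innerDl x y z : inner (x + y) z = inner x z + inner y z.
Proof. exact: linearDl. Qed.

Lemma innerBl x y z : inner (x - y) z = inner x z - inner y z.
Proof. exact: linearBl. Qed.

Lemma innerBr x y z : inner x (y - z) = inner x y - inner x z.
Proof. exact: linearBr. Qed.

Lemma innerZl a x y : inner (a *: x) y = a * inner x y.
Proof. exact: linearZl_LR. Qed.

Lemma innerZr a x y : inner x (a *: y) = conjs a * inner x y.
Proof. exact: linearZr_LR. Qed.

Lemma inner0l x : inner 0 x = 0.
Proof. exact: linear0l. Qed.

Lemma inner_conj x y : inner x y = conjs (inner y x).
Proof. by rewrite (hermC inner) expr0 mul1r. Qed.

Lemma inner_eq0C x y : inner x y = 0 -> inner y x = 0.
Proof. by move=> xy; rewrite inner_conj xy rmorph0. Qed.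

Lemma inner_proj u x : u != 0 ->
  inner (x - (inner x u / `|u| ^+ 2) *: u) u = 0.
Proof.
move=> u0; rewrite innerBl innerZl -sqr_norm_inner divfK ?subrr//.
by rewrite expf_neq0// normr_eq0.
Qed.

(** Cauchy-Schwarz: split [x = w + c *: u] with [w] orthogonal to [u]. Pythagoras bounds the norm of
    [c *: u] by that of [x], and [inner x u] is [c] times the square of the norm of [u]. *)
Lemma norm_inner_le x u : `|inner x u| <= `|x| * `|u|.
Proof.
have [->|u0] := eqVneq u 0.
  by rewrite normr0 mulr0 inner_conj inner0l rmorph0 normr0.
have nu0 : 0 < `|u| by rewrite normr_gt0.
have := inner_proj _ x u0; set c := _ / _; set w := x - _ => wu.
have xE : x = w + c *: u by rewrite /w subrK.
have pyth : `|x| ^+ 2 = `|w| ^+ 2 + (`|c| * `|u|) ^+ 2.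
  have ortho : inner w (c *: u) = 0 by rewrite innerZr wu mulr0.
  have -> : `|x| ^+ 2 = `|w| ^+ 2 + inner (c *: u) (c *: u).
    by rewrite !sqr_norm_inner xE; exact: (hnormDd ortho).
  by rewrite innerZl innerZr -sqr_norm_inner mulrA mulr_conjs exprMn.
have -> : inner x u = c * `|u| ^+ 2.
  by rewrite divfK// expf_neq0// normr_eq0.
rewrite normrM normrX normr_id expr2 mulrA ler_pM2r//.
by rewrite -(@ler_pXn2r _ 2) ?nnegrE ?mulr_ge0// pyth lerDr exprn_ge0.
Qed.

End inner_theory.

Section rank_one.
Context {R : realType} {K : rclikeType R} {H : hilbertType K}.

Lemma rank_one_bounded (u w : H) :
  (fun x : H => inner x u *: w) \in @bounded_linear R K H H.
Proof.
rewrite inE; split=> [a x y|]; first by rewrite innerDl innerZl scalerDl scalerA.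
exists (`|u| * `|w|) => x; rewrite normrZ (mulrC _ `|x|) mulrA.
by rewrite ler_wpM2r// norm_inner_le.
Qed.

Definition rank_one (u w : H) : boundedOp H H :=
  exist (fun f => f \in @bounded_linear R K H H) _ (rank_one_bounded u w).

Lemma rank_oneE u w x : rank_one u w x = inner x u *: w.
Proof. by []. Qed.

(* These T are exactly the [rank_one u w] with w orthogonal to u (for u != 0);
   this description makes closedness a matter of pointwise limits. *)
Definition ortho_rank_one (u : H) : set (boundedOp H H) :=
  [set T | (forall x, inner x u = 0 -> T x = 0) /\ inner (T u) u = 0].

Lemma ortho_rank_one_submod u : submod_closed (mem (ortho_rank_one u)).
Proof.
split=> [|a S T]; rewrite ?inE; first by split=> [x _|]; rewrite boundedOp0 ?inner0l.
move=> [S0 Su] [T0 Tu]; split=> [x xu|].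
  by rewrite boundedOpD boundedOpZ S0// T0// scaler0 addr0.
by rewrite boundedOpD boundedOpZ innerDl innerZl Su Tu mulr0 addr0.
Qed.

Lemma closure_boundedOp (E : set (boundedOp H H)) (T : boundedOp H H) (e : K) :
  closure E T -> 0 < e ->
  exists2 S : boundedOp H H, E S & forall x, `|T x - S x| <= e * `|x|.
Proof.
move=> clT e0; have [S [ES]] := clT _ (nbhsx_ballx T e e0).
rewrite -ball_normE /ball_ /= => TS.
exists (S : boundedOp H H) => // x.
have -> : T x - (S : boundedOp H H) x = (T - S : boundedOp H H) x by [].
by rewrite (le_trans (le_opnorm _ _))// ler_wpM2r// -opnormE ltW.
Qed.

(** Both conditions equate to 0 a quantity depending continuously on a single value of [T], so they
    survive approximation in operator norm. *)
Lemma ortho_rank_one_closed u : closed (ortho_rank_one u).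
Proof.
move=> /= T clT; have approx e := @closure_boundedOp _ T e clT.
split=> [x xu|].
  apply: (normr_le_eps_eq0 _ _ _ `|x|) => // e e0.
  by have [S [S0 _] /(_ x)] := approx _ e0; rewrite S0// subr0.
(* [inner (T u) u] is a scalar, so [K] is taken as a normed space over itself. *)
apply: (normr_le_eps_eq0 K K^o _ (`|u| * `|u|)) => [|e e0]; first exact: mulr_ge0.
have [S [_ Su] /(_ u) TS] := approx _ e0.
rewrite -[inner _ _]subr0 -Su -innerBl (le_trans (norm_inner_le _ _))//.
by rewrite mulrA ler_wpM2r.
Qed.

(** Since [T u] is orthogonal to [u], it is killed by [T]. The quadratic form at [u - T u] is
    therefore minus the squared norm of [T u], which forces [T u = 0]. *)
Lemma ortho_rank_one_psd u (T : boundedOp H H) : u != 0 ->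
  ortho_rank_one u T -> positive_semidefinite T -> T = 0.
Proof.
move=> u0 [T0 Tuu] /(_ (u - T u)).
have -> : T (u - T u) = T u.
  by rewrite [LHS](linearB T) [X in _ - X](T0 _ Tuu) subr0.
rewrite innerBr Tuu sub0r -sqr_norm_inner.
rewrite oppr_ge0 real_exprn_even_le0 ?normr_real//= normr_eq0 => /eqP Tu0.
apply: boundedOp_ext => x; rewrite boundedOp0.
(* [T] vanishes both on the multiple of [u] and on the part of [x] orthogonal to [u]. *)
rewrite -[x](subrK ((inner x u / `|u| ^+ 2) *: u)) [LHS](linearD T).
rewrite [X in _ + X](linearZ_LR T) [X in _ + _ *: X]Tu0 scaler0 addr0.
by apply: T0; exact: inner_proj.
Qed.

(** If the operators [e i] span, then [u] and the vectors [e i u] span [H]: the part [w] of [x]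
    orthogonal to [u] is recovered, up to a nonzero scalar, as [rank_one u w u]. *)
Lemma ortho_rank_one_infinite u : u != 0 ->
  ~ finite_dimensional [set: H] -> ~ finite_dimensional (ortho_rank_one u).
Proof.
move=> u0 Hinf [n [e [_ spanE]]]; apply: Hinf.
pose f : 'I_n -> boundedOp H H := e.
have nu0 : `|u| ^+ 2 != 0 by rewrite expf_neq0// normr_eq0.
(* Index 0 carries [u]; the other [n] indices carry the [f j u]. *)
exists n.+1, (fun i => oapp (fun j => f j u) u (unlift ord0 i)).
split=> // x _ /=.
set c := inner x u / `|u| ^+ 2; pose w := x - c *: u.
have /spanE[d dE] : ortho_rank_one u (rank_one u w).
  by split=> [y yu|]; rewrite rank_oneE ?yu ?scale0r// innerZl inner_proj ?mulr0.
have wE : w = \sum_(i < n) (d i / `|u| ^+ 2) *: f i u.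
  have -> : w = (`|u| ^+ 2)^-1 *: rank_one u w u.
    by rewrite rank_oneE -sqr_norm_inner scalerA mulVf// scale1r.
  rewrite dE -/f; have -> : (\sum_(i < n) d i *: f i : boundedOp H H) u =
      \sum_(i < n) d i *: f i u.
    by elim/big_ind2 : _ => // [S y T z <- <-].
  by rewrite scaler_sumr; apply: eq_bigr => i _; rewrite scalerA mulrC.
exists (fun i => oapp (fun j => d j / `|u| ^+ 2) c (unlift ord0 i)).
rewrite big_ord_recl unlift_none/= -[LHS](subrKC (c *: u)) -/w wE.
by congr (_ + _); apply: eq_bigr => i _; rewrite liftK.
Qed.

End rank_one.

Theorem corollary4p8 (R : realType) (K : rclikeType R) (H : hilbertType K)
    (H_separable : separable H)
    (H_infinite : ~ finite_dimensional [set: H]) :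
  spaceable [set T : boundedOp H H | ~ positive_semidefinite T].
Proof.
have [u u0] : exists u : H, u != 0.
  (* Without a nonzero vector, the empty family would span [H]. *)
  apply: contrapT => noH; apply: H_infinite; exists 0, (fun=> 0); split=> // x _.
  exists (fun=> 0); rewrite big_ord0; apply: contrapT => /eqP x0.
  by apply: noH; exists x.
exists (ortho_rank_one u); split.
- exact: ortho_rank_one_submod.
- exact: ortho_rank_one_closed.
- exact: ortho_rank_one_infinite.
- move=> T ET; have [Tpsd|] := pselect (positive_semidefinite T); last by left.
  by right; exact: (ortho_rank_one_psd _ _ u0 ET Tpsd).
Qed.
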